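(* Let $G=(V,E)$ be a graph with $V=\{v_1,v_2,\ldots,v_{|V|}\}$. Let $A\in\mathbb{R}^{|V|\times|E|}$ be the (signed) incidence matrix of $G$ with the arc directions designated arbitrarily. Let $I\subseteq V$, $L\subseteq E$ and $P\subseteq V$ be given. Let $M_I$ be the submatrix of the $|V|\times|V|$ identity matrix consisting of the rows corresponding to $I$, let $M_L$ be the submatrix of the $|E|\times|E|$ identity matrix consisting of the rows corresponding to $L$, and let $M_P$ be the submatrix of the $|V|\times|V|$ identity matrix consisting of the rows corresponding to $P$. Let $0$ denote an additional node not in $V$ and let $E_{P0}:=\{\{i,0\}\mid i\in P\}$. Then the matrix $$H_p(\tilde D):=\begin{bmatrix} M_I A\tilde D A^T\\ M_L\tilde D A^T\\ M_P\end{bmatrix}$$ has full column rank (i.e., rank $|V|$) for almost all diagonal matrices $\tilde D\in\mathbb{R}^{|E|\times|E|}$ if and only if there exists a function $g:I\to E$, with the constraint that $i\in g(i)$ for all $i\in I$, such that the graph $(V\cup\{0\},\,L\cup E_{P0}\cup g(I))$ is connected, where $g(I):=\{g(i)\mid i\in I\}$.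
   Context: Graphs are finite and undirected; an edge is an unordered pair $\{i,j\}$ of its two end nodes. The signed incidence matrix $A$ has one row per node and one column per edge; after choosing a direction for each edge, the column of an edge has entry $+1$ at one end node, $-1$ at the other end node, and $0$ elsewhere. ''Almost all diagonal $\tilde D$'' means for all diagonal entries $(\tilde D_{ee})_{e\in E}\in\mathbb{R}^{|E|}$ outside a set of Lebesgue measure zero. Connectivity of $(V,E)$ itself is not assumed. (Interpretation: $I$, $L$, $P$ are the sets of buses with protected injection measurements, lines with protected power flow measurements, and buses whose phasors are measured by protected phasor measurement units.)
   Formalization: The formal theorem additionally assumes that every node in both I and P is an end of at least one edge of E; without it the claim fails, e.g. for V = I = P = {v} and E empty, where H_p has full column rank but no g exists. *)

(* Defs.v *)
From HB Require Import structures.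
From mathcomp Require Import all_boot all_order all_algebra.
From mathcomp Require Import all_classical all_reals all_analysis.

Set Implicit Arguments.
Unset Strict Implicit.
Unset Printing Implicit Defensive.

Import Order.TTheory GRing.Theory Num.Theory.

Local Open Scope classical_set_scope.
Local Open Scope ring_scope.

Section LebesgueTuple.
Context {R : realType}.
Local Notation RR := (measurableTypeR R).

Definition tcons n (x : RR * n.-tuple RR) : n.+1.-tuple RR :=
  [tuple of x.1 :: x.2].

Lemma measurable_tcons n : measurable_fun setT (@tcons n).
Proof. exact: measurable_cons. Qed.

Section Step.
Variables (n : nat) (mu : {sigma_finite_measure set (n.-tuple RR) -> \bar R}).

Definition lebesgue_cons : set (n.+1.-tuple RR) -> \bar R :=
  pushforward (lebesgue_measure \x mu)%E (@tcons n).

Let lebesgue_cons0 : lebesgue_cons set0 = 0%E.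
Proof. by rewrite /lebesgue_cons /pushforward preimage_set0 measure0. Qed.

Let lebesgue_cons_ge0 A : (0 <= lebesgue_cons A)%E.
Proof. by rewrite /lebesgue_cons /pushforward measure_ge0. Qed.

Let lebesgue_cons_sigma_additive : semi_sigma_additive lebesgue_cons.
Proof.
move=> F mF tF mUF; rewrite /lebesgue_cons /pushforward preimage_bigcup.
apply: measure_semi_sigma_additive.
- by move=> k; rewrite -[X in measurable X]setTI; exact: measurable_tcons.
- apply/trivIsetP => /= i j _ _ ij; rewrite -preimage_setI.
  by move/trivIsetP : tF => /(_ _ _ _ _ ij) ->//; rewrite preimage_set0.
- by rewrite -preimage_bigcup -[X in measurable X]setTI; exact: measurable_tcons.
Qed.

HB.instance Definition _ := isMeasure.Build _ _ _ lebesgue_cons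
  lebesgue_cons0 lebesgue_cons_ge0 lebesgue_cons_sigma_additive.

Lemma lebesgue_consE (A : set RR) (B : set (n.-tuple RR)) :
  measurable A -> measurable B ->
  lebesgue_cons [set x | A (thead x) /\ B [tuple of behead x]] =
  (lebesgue_measure A * mu B)%E.
Proof.
move=> mA mB; rewrite -product_measure1E// /lebesgue_cons /pushforward.
congr (_ _); apply/seteqP; split => -[a t] /=; rewrite theadE.
  by move=> [Aa]; rewrite (_ : [tuple of _] = t)//; exact/val_inj.
by move=> [Aa Bt]; split => //; rewrite (_ : [tuple of _] = t)//; exact/val_inj.
Qed.

Let lebesgue_cons_sigma_finite : sigma_finite setT lebesgue_cons.
Proof.
have /sigma_finiteP[F [FT ndF mF]] := sigma_finiteT (@lebesgue_measure R).
have /sigma_finiteP[G [GT ndG mG]] := sigma_finiteT mu.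
exists (fun k => [set x | F k (thead x) /\ G k [tuple of behead x]]).
  apply/seteqP; split => // x _.
  have [i _ Fi] : (\bigcup_i F i) (thead x) by rewrite -FT.
  have [j _ Gj] : (\bigcup_j G j) [tuple of behead x] by rewrite -GT.
  exists (maxn i j) => //; split.
    by move: Fi; exact/subsetPset/ndF/leq_maxl.
  by move: Gj; exact/subsetPset/ndG/leq_maxr.
move=> k; have [mFk Fk] := mF k; have [mGk Gk] := mG k; split.
  apply: measurableI; rewrite -[X in measurable X]setTI.
    exact: measurable_tnth.
  exact: measurable_behead.
by rewrite lebesgue_consE// lte_mul_pinfty// ge0_fin_numE.
Qed.

HB.instance Definition _ := Measure_isSigmaFinite.Build _ _ _ lebesgue_cons
  lebesgue_cons_sigma_finite.

End Step.

(* Lebesgue measure on (the Borel sets of) R^n, as the n-fold product of the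
   one-dimensional measure; R^0 is a single point of mass 1.  The null sets of
   its completion are its [negligible] sets, which is what [{ae _, _}] uses. *)
Fixpoint lebesgue_tuple (n : nat) :
    {sigma_finite_measure set (n.-tuple RR) -> \bar R} :=
  match n with
  | 0 => \d_[tuple]
  | m.+1 => lebesgue_cons (lebesgue_tuple m)
  end.

Lemma lebesgue_tuple_box n (A : 'I_n -> set RR) :
  (forall i, measurable (A i)) ->
  lebesgue_tuple n [set x | forall i, A i (tnth x i)] =
  (\prod_(i < n) lebesgue_measure (A i))%E.
Proof.
elim: n A => [|n IH] A mA.
  rewrite big_ord0 (_ : [set x | _] = setT); first exact: diracT.
  by apply/seteqP; split => // x _ [].
have mB : measurable [set x : n.-tuple RR | forall i, A (lift ord0 i) (tnth x i)].
  rewrite (_ : mkset _ = \bigcap_(i in [set: 'I_n])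
     ((fun x : n.-tuple RR => tnth x i) @^-1` A (lift ord0 i))).
    apply: fin_bigcap_measurable => // i _; rewrite -[X in measurable X]setTI.
    exact: measurable_tnth.
  by apply/seteqP; split => x /= xA i; [move=> _|]; exact: xA.
rewrite big_ord_recl -IH// -lebesgue_consE//=; congr (_ _).
apply/seteqP; split => x /= xA.
  split; first exact: xA.
  by move=> i; have := xA (lift ord0 i); rewrite {1}(tuple_eta x) tnthS.
move=> i; case: (unliftP ord0 i) => [j|] ->; last exact: xA.1.
by rewrite (tuple_eta x) tnthS; exact: xA.2.
Qed.

End LebesgueTuple.

Section Graphs.
Variable V : finType.

Definition simple_graph (E : {set {set V}}) : Prop :=
  forall e, e \in E -> #|e| = 2%N.

Definition edge (E : {set {set V}}) := {e : {set V} | e \in E}.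

Definition adjacent (F : {set {set V}}) : rel V :=
  fun u v => [set u; v]%SET \in F.

Definition connected_graph (F : {set {set V}}) : Prop :=
  forall u v : V, connect (adjacent F) u v.

(* Rows and columns are indexed through the enumerations of V and of the
   edges; the direction of each edge is chosen by the pair (u, v). *)
Definition is_incidence_matrix (R : realType) (E : {set {set V}})
    (A : 'M[R]_(#|V|, #|{: edge E}|)) : Prop :=
  forall k : 'I_#|{: edge E}|, exists u v : V,
    [/\ u != v, val (enum_val k) = [set u; v]%SET &
        forall i : 'I_#|V|,
          A i k = (enum_val i == u)%:R - (enum_val i == v)%:R].

(* The graph lives on [option V], [None] being the additional node 0. *)
Definition lift_edge (e : {set V}) : {set option V} := Some @: e.

Definition augmented_edges (E : {set {set V}}) (L : {set edge E})
    (P I : {set V}) (g : {i : V | i \in I} -> edge E) :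
    {set {set option V}} :=
  ([set lift_edge (val e) | e in L]
   :|: [set [set Some i; None] | i in P]
   :|: [set lift_edge (val (g i)) | i : {i : V | i \in I}])%SET.

End Graphs.

Definition identity_rows (R : realType) (T : finType) (S : {set T}) :
    'M[R]_(#|S|, #|T|) :=
  rowsub (fun k : 'I_#|S| => enum_rank (enum_val k)) 1%:M.

Definition Hp (R : realType) (V : finType) (E : {set {set V}})
    (A : 'M[R]_(#|V|, #|{: edge E}|)) (I P : {set V}) (L : {set edge E})
    (D : 'M[R]_#|{: edge E}|) : 'M[R]_(#|I| + (#|L| + #|P|), #|V|) :=
  col_mx (identity_rows R I *m A *m D *m A^T)
    (col_mx (identity_rows R L *m D *m A^T) (identity_rows R P)).

Definition diag_of_tuple (R : realType) n (d : n.-tuple R) : 'M[R]_n :=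
  diag_mx (\row_j tnth d j).

(* Main.v *)
Require Import Defs.
From HB Require Import structures.
From mathcomp Require Import all_boot all_order all_algebra.
From mathcomp Require Import all_classical all_reals all_analysis.
From mathcomp Require Import measurable_realfun.

Set Implicit Arguments.
Unset Strict Implicit.
Unset Printing Implicit Defensive.

Import Order.TTheory GRing.Theory Num.Theory.

Local Open Scope classical_set_scope.
Local Open Scope ring_scope.

(** A vector [x] in the kernel of [Hp] is a potential on the nodes: it vanishes
on [P], the weight of each line of [L] times the potential drop along it is
zero, and at each node of [I] the weighted drops of the incident edges sum to
zero.  On the combinatorial side, the graph with node 0 and edge set [K] is
connected exactly when [K] determines potentials, meaning that the only
potential that vanishes on [P] and is constant on every edge of [K] is zero
([connected_groundedP]).  Both directions then compare systems of linear
equations on potentials.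

If [Hp] has full rank for some weights, the row of a node [i] of [I] is a
combination of the rows of the transposed incidence matrix at the edges
incident to [i].  Dropping one row from a full system loses at most one
dimension, and some incident edge restores it, so the rows of [I] can be
exchanged one at a time for rows of edges [g i] ([row_full_choice],
[row_full_assignment]).  The resulting system says that [L] and the edges [g i]
determine potentials.  The exchange needs a first edge at every node of [I]: a
node outside [P] without edges would be a zero column of [Hp], and nodes of
both [I] and [P] have an edge by hypothesis ([incident_edge]).

Conversely, the minors of [Hp] are polynomials in the weights, and a polynomial
that is nonzero somewhere vanishes only on a null set ([polyfun_zeros_null]),
so one good choice of weights is enough ([ae_row_full]).  Weights 0 and 1 work:
start from weight 1 on [L] and on the edges [g j] for [j] in a set [S], and
direct each [g j] away from [j].  If a nonzero potential remains in the kernel,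
the balance equations force a directed cycle of edges [g j]; one edge of a
cycle is redundant, so [S] can be shrunk and the argument repeated
([assignment_row_full]). *)

(** * Polynomial functions and null sets *)

Section PolynomialFunctions.
Context {R : realType}.
Local Notation RR := (measurableTypeR R).

(** Closure under the ring operations is all that the argument needs of
multivariate polynomials: measurability, slicing and restriction to a line all
go by induction on it. *)
Inductive polyfun n : (n.-tuple RR -> R) -> Prop :=
| polyfun_cst c : polyfun (fun=> c)
| polyfun_coord i : polyfun (fun d => tnth d i)
| polyfunD f g : polyfun f -> polyfun g -> polyfun (fun d => f d + g d)
| polyfunM f g : polyfun f -> polyfun g -> polyfun (fun d => f d * g d).

Lemma polyfun_sum n (J : Type) (s : seq J) (p : pred J)
    (f : J -> n.-tuple RR -> R) :
  (forall j, polyfun (f j)) -> polyfun (fun d => \sum_(j <- s | p j) f j d).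
Proof.
move=> pf; elim: s => [|j s IH].
  rewrite (_ : (fun=> _) = fun=> 0); first exact: polyfun_cst.
  by apply/funext => d; rewrite big_nil.
rewrite (_ : (fun=> _) =
    fun d => (if p j then f j d else 0) + \sum_(j <- s | p j) f j d).
  by apply: polyfunD => //; case: (p j) => //; exact: polyfun_cst.
by apply/funext => d; rewrite big_cons; case: ifP => // _; rewrite add0r.
Qed.

Lemma polyfun_prod n (J : Type) (s : seq J) (f : J -> n.-tuple RR -> R) :
  (forall j, polyfun (f j)) -> polyfun (fun d => \prod_(j <- s) f j d).
Proof.
move=> pf; elim: s => [|j s IH].
  rewrite (_ : (fun=> _) = fun=> 1); first exact: polyfun_cst.
  by apply/funext => d; rewrite big_nil.
rewrite (_ : (fun=> _) = fun d => f j d * \prod_(j <- s) f j d).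
  exact: polyfunM.
by apply/funext => d; rewrite big_cons.
Qed.

Lemma polyfun_det n m (M : n.-tuple RR -> 'M[R]_m) :
  (forall i j, polyfun (fun d => M d i j)) -> polyfun (fun d => \det (M d)).
Proof.
move=> pM; apply: polyfun_sum => s.
by apply: polyfunM; [exact: polyfun_cst | exact: polyfun_prod].
Qed.

Lemma measurable_polyfun n (f : n.-tuple RR -> R) :
  polyfun f -> measurable_fun setT (f : n.-tuple RR -> RR).
Proof.
elim=> [c|i|{}f g _ mf _ mg|{}f g _ mf _ mg].
- exact: measurable_cst.
- exact: measurable_tnth.
- exact: measurable_funD.
- exact: measurable_funM.
Qed.

Lemma polyfun_slice n (f : n.+1.-tuple RR -> R) (s : RR) :
  polyfun f -> polyfun (fun t : n.-tuple RR => f (tcons (s, t))).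
Proof.
elim=> [c|i|{}f g _ pf _ pg|{}f g _ pf _ pg].
- exact: polyfun_cst.
- case: (unliftP ord0 i) => [j|] ->; last exact: polyfun_cst.
  rewrite (_ : (fun=> _) = fun d => tnth d j); first exact: polyfun_coord.
  by apply/funext => t; rewrite tnthS.
- exact: polyfunD.
- exact: polyfunM.
Qed.

Lemma polyfun_line n (f : n.+1.-tuple RR -> R) (t : n.-tuple RR) :
  polyfun f -> exists p : {poly R}, forall s, f (tcons (s, t)) = p.[s].
Proof.
elim=> [c|i|{}f g _ [p fE] _ [q gE]|{}f g _ [p fE] _ [q gE]].
- by exists c%:P => s; rewrite hornerC.
- case: (unliftP ord0 i) => [j|] ->; last by exists 'X => s; rewrite hornerX.
  by exists (tnth t j)%:P => s; rewrite hornerC tnthS.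
- by exists (p + q) => s; rewrite hornerD fE gE.
- by exists (p * q) => s; rewrite hornerM fE gE.
Qed.

Lemma finite_roots (p : {poly R}) : p != 0 -> finite_set [set s | p.[s] = 0].
Proof.
move=> p0; apply: contrapT => /(infinite_set_fset (size p))[B Bp].
rewrite leqNgt => /negP; apply; apply: (max_poly_roots p0) => //.
  by apply/allP => s sB; apply/rootP; exact: Bp.
by rewrite finmap.fset_uniq.
Qed.

(** By Fubini and induction on [n]: along the line through the tail of [d0], [f]
is a nonzero univariate polynomial, so for all but finitely many first
coordinates the slice of [f] is a polynomial function that is nonzero at the
tail of [d0]. *)
Lemma polyfun_zeros_null n (f : n.-tuple RR -> R) (d0 : n.-tuple RR) :
  polyfun f -> f d0 != 0 -> lebesgue_tuple n [set d | f d = 0] = 0%E.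
Proof.
elim: n f d0 => [|n IH] f d0 pf f0.
  rewrite (_ : [set d | _] = set0) ?measure0//.
  apply/seteqP; split => // d /= fd; move/eqP: f0; apply.
  by rewrite (tuple0 d0) -(tuple0 d).
have mf0 m (g : m.-tuple RR -> R) : polyfun g -> measurable [set d | g d = 0].
  move=> pg; rewrite (_ : mkset _ = setT `&` g @^-1` [set 0]).
    exact: (measurable_polyfun pg).
  by rewrite setTI.
have mN : measurable (@tcons R n @^-1` [set d | f d = 0]).
  rewrite -[X in measurable X]setTI.
  by apply: measurable_tcons => //; exact: mf0.
rewrite /= /lebesgue_cons /pushforward /=.
rewrite /product_measure1 /=.
rewrite (@ae_eq_integral _ _ _ _ _ (cst 0%E)) ?integral0//.
  exact: measurable_fun_xsection.
have [p pE] := polyfun_line [tuple of behead d0] pf.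
have p0 : p != 0.
  apply: contraNneq f0 => p0; have := pE (thead d0).
  rewrite p0 horner0 => <-; apply/eqP; congr f.
  by rewrite {1}(tuple_eta d0).
exists [set s : RR | p.[s] = 0]; split.
- apply: countable_measurable; first by move=> t; exact: measurable_set1.
  by apply: finite_set_countable; exact: finite_roots.
- apply: countable_lebesgue_measure0.
  by apply: finite_set_countable; exact: finite_roots.
move=> s /=; apply: contra_notP => /eqP ps _.
rewrite (_ : xsection _ _ = [set t | f (tcons (s, t)) = 0]); last first.
  by apply/seteqP; split => t; rewrite /xsection /= inE.
apply: IH [tuple of behead d0] _ _; first exact: polyfun_slice.
by rewrite pE.
Qed.

Lemma ae_polyfun_neq0 n (f : n.-tuple RR -> R) (d0 : n.-tuple RR) :
  polyfun f -> f d0 != 0 -> {ae lebesgue_tuple n, forall d, f d != 0}.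
Proof.
move=> pf f0; exists [set d | f d = 0]; split.
- rewrite -[X in measurable X]setTI.
  exact: (measurable_polyfun pf measurableT (measurable_set1 0)).
- exact: polyfun_zeros_null f0.
- by move=> d /= /negP; rewrite negbK => /eqP.
Qed.

(** It lets a property that holds almost everywhere be realised at a point. *)
Lemma lebesgue_tuple_gt0 n : (0 < lebesgue_tuple n [set: n.-tuple RR])%E.
Proof.
have -> : [set: n.-tuple RR] = [set x | forall i : 'I_n, [set: RR] (tnth x i)].
  by apply/seteqP; split.
rewrite (@lebesgue_tuple_box _ _ (fun=> setT))//.
apply: (big_ind (fun x => 0 < x)%E).
- exact: lte01.
- by move=> x y; exact: mule_gt0.
- by move=> i _; rewrite -set_itvNyy lebesgue_measure_itv /= ltey.
Qed.

End PolynomialFunctions.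

(** * Connectivity and potentials *)

Section Potentials.
Variables (R : realType) (V : finType) (E : {set {set V}}).
Hypothesis simpleE : simple_graph E.

Definition flat (x : V -> R) (e : {set V}) : Prop :=
  forall u v, u \in e -> v \in e -> x u = x v.

(** The additional node [None] acts as the ground, to which the nodes of [P] are
tied. *)
Definition grounded_edges (K : {set edge E}) (P : {set V}) :
    {set {set option V}} :=
  ([set lift_edge (val e) | e in K] :|: [set [set Some i; None] | i in P])%SET.

Definition determines (K : {set edge E}) (P : {set V}) : Prop :=
  forall x : V -> R, (forall p, p \in P -> x p = 0) ->
    (forall e, e \in K -> flat x (val e)) -> forall v, x v = 0.

Lemma other_end (e : edge E) u v :
  u \in val e -> v \in val e -> u != v -> val e = [set u; v]%SET.
Proof.
move=> ue ve uv; apply/esym/eqP; rewrite eqEcard cards2 uv (simpleE (valP e)).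
by rewrite leqnn andbT finset.subUset !finset.sub1set ue.
Qed.

Lemma adjacent_sym (T : finType) (F : {set {set T}}) :
  symmetric (Defs.adjacent F).
Proof. by move=> u v; rewrite /Defs.adjacent finset.setUC. Qed.

(** A potential extended by 0 at the ground is constant along paths; conversely,
the indicator of the nodes not connected to the ground is a potential. *)
Lemma connected_groundedP (K : {set edge E}) (P : {set V}) :
  connected_graph (grounded_edges K P) <-> determines K P.
Proof.
split=> [conn x xP xK v | det].
  pose y o := if o is Some u then x u else 0.
  have yadj a b : Defs.adjacent (grounded_edges K P) a b -> y a = y b.
    rewrite /Defs.adjacent => abF.
    have [aab bab] : a \in [set a; b]%SET /\ b \in [set a; b]%SET.
      by rewrite !inE !eqxx orbT.
    case/finset.setUP: abF => /imsetP[e eK abE]; move: aab bab; rewrite abE.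
      by move=> /imsetP[u ue ->] /imsetP[w we ->]; exact: xK eK _ _ ue we.
    by rewrite !inE => /orP[]/eqP-> /orP[]/eqP->; rewrite /= ?xP.
  have yconn : fingraph.closed (Defs.adjacent (grounded_edges K P))
      [pred a | y a == 0].
    by move=> a b ab; rewrite !inE (yadj _ _ ab).
  have := closed_connect yconn (conn (Some v) None).
  by rewrite !inE eqxx => /eqP.
set F := grounded_edges K P.
have sF : connect_sym (Defs.adjacent F) by apply/sym_connect_sym/adjacent_sym.
suff conn0 a : connect (Defs.adjacent F) a None.
  by move=> a b; apply: connect_trans (conn0 a) _; rewrite sF.
case: a => // v.
pose x u : R := (~~ connect (Defs.adjacent F) (Some u) None)%:R.
have /eqP : x v = 0.
  apply: det => [p pP|e eK u w ue we].
    rewrite /x connect1// /Defs.adjacent; apply/finset.setUP; right.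
    by apply/imsetP; exists p.
  have [->//|uw] := eqVneq u w.
  have uwF : connect (Defs.adjacent F) (Some u) (Some w).
    apply: connect1; apply/finset.setUP; left; apply/imsetP; exists e => //.
    by rewrite (other_end ue we uw) /lift_edge imsetU !imset_set1.
  by rewrite /x (same_connect sF uwF).
by rewrite pnatr_eq0 eqb0 negbK.
Qed.

Lemma augmented_edgesE (L : {set edge E}) (P I : {set V})
    (g : {i : V | i \in I} -> edge E) :
  augmented_edges L P g =
  grounded_edges (L :|: [set g i | i : {i : V | i \in I}])%SET P.
Proof.
apply/finset.setP => e.
rewrite /augmented_edges /grounded_edges imsetU -imset_comp.
by rewrite !inE orbAC.
Qed.

End Potentials.

(** * Exchanging rows in a matrix of full rank *)

Section LinearAlgebra.
Variable F : fieldType.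

Lemma row_full_kerP m n (M : 'M[F]_(m, n)) :
  row_full M <-> forall y : 'cV[F]_n, M *m y = 0 -> y = 0.
Proof.
split=> [/row_fullP[B BM] y My0|ker0].
  by rewrite -(mul1mx y) -BM -mulmxA My0 mulmx0.
rewrite /row_full -mxrank_tr -/(row_free M^T) -kermx_eq0.
apply/eqP/row_matrixP => i; rewrite row0; apply: trmx_inj; rewrite trmx0.
apply: ker0; apply: trmx_inj.
by rewrite trmx_mul trmxK -row_mul mulmx_ker row0 trmx0.
Qed.

(** Either every candidate [X k] lies in [U], and then so does [w] and [U] is
already full, or some candidate lies outside [U], which has corank at most 1. *)
Lemma row_full_exchange n (K : finType) (C : pred K) (X : K -> 'rV[F]_n)
    (U : 'M[F]_n) (w : 'rV[F]_n) :
  (exists k, C k) -> (w <= \sum_(k | C k) <<X k>>)%MS ->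
  row_full (U + <<w>>)%MS -> exists2 k, C k & row_full (U + <<X k>>).
Proof.
move=> [k0 Ck0] wX fullr.
have [XU|/forallPn[k]] := boolP [forall k, C k ==> (X k <= U)%MS].
  exists k0 => //; rewrite -!sub1mx in fullr *.
  apply: submx_trans fullr _; rewrite addsmx_sub addsmxSl genmxE.
  apply: submx_trans (addsmxSl _ _); apply: submx_trans wX _.
  by apply/sumsmx_subP => k Ck; rewrite genmxE; exact: (implyP (forallP XU k)).
rewrite negb_imply => /andP[Ck XkU]; exists k => //.
have ltU : (U < U + <<X k>>)%MS.
  rewrite ltmxE addsmxSl /=; apply: contra XkU; apply: submx_trans.
  by rewrite -(genmxE (X k)) addsmxSr.
rewrite /row_full eqn_leq rank_leq_col /=; apply: leq_trans (rank_ltmx ltU).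
move/eqP: fullr => {1}<-; apply: leq_trans (mxrank_adds_leqif _ _) _.
by rewrite -(addn1 (\rank U)) leq_add2l genmxE rank_leq_row.
Qed.

(** The rows [w j] are exchanged one at a time: those still present and those
already exchanged together play the part of [U] in the single exchange. *)
Lemma row_full_choice n (J K : finType) (C : J -> pred K) (X : K -> 'rV[F]_n)
    (w : J -> 'rV[F]_n) (U : 'M[F]_n) :
  (forall j, exists k, C j k) ->
  (forall j, w j <= \sum_(k | C j k) <<X k>>)%MS ->
  row_full (U + \sum_j <<w j>>)%MS ->
  exists g : J -> K, (forall j, C j (g j)) /\
    row_full (U + \sum_j <<X (g j)>>)%MS.
Proof.
move=> C0 wX; elim: (index_enum J) (index_enum_uniq J) U => [_ U|j s IH].
  rewrite big_nil; have [g gC] := fin_all_exists C0.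
  by exists g; rewrite big_nil.
move=> /= /andP[js us] U; rewrite big_cons addsmxA addsmxC addsmxA.
move=> /(row_full_exchange (C0 j) (wX j))[k Cjk].
rewrite -addsmxA addsmxC => /(IH us)[g [gC gfull]].
exists (fun i => if i == j then k else g i); split.
  by move=> i; case: eqP => // ->.
rewrite big_cons eqxx addsmxA (eq_big_seq (fun i => <<X (g i)>>%MS))// => i si.
case: eqP => // ij.
by rewrite -ij si in js.
Qed.
End LinearAlgebra.

(** * The kernel of the measurement matrix *)

Section WeightedSystem.
Variables (R : realType) (V : finType) (E : {set {set V}}).
Variable A : 'M[R]_(#|V|, #|{: edge E}|).
Hypothesis incA : is_incidence_matrix A.

Definition potential_col (x : V -> R) : 'cV[R]_#|V| := \col_i x (enum_val i).

(** The sign depends on the direction of the edge in [A]. *)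
Definition edge_drop (x : V -> R) (e : edge E) : R :=
  (A^T *m potential_col x) (enum_rank e) 0.

Lemma incidence_neq0 i (e : edge E) :
  (A (enum_rank i) (enum_rank e) != 0) = (i \in val e).
Proof.
have [u [v [uv]]] := incA (enum_rank e); rewrite enum_rankK => -> ->.
rewrite enum_rankK !inE; have [->|iu] := eqVneq i u.
  by rewrite (negPf uv) subr0 oner_neq0.
by have [_|_] := eqVneq i v; rewrite ?sub0r ?subr0 ?oppr_eq0 ?oner_neq0 ?eqxx.
Qed.

Lemma edge_drop_eq0P (x : V -> R) (e : edge E) :
  edge_drop x e = 0 <-> flat x (val e).
Proof.
have [u [v [uv]]] := incA (enum_rank e); rewrite enum_rankK => eE AE.
have -> : edge_drop x e = x u - x v.
  have pick w : \sum_(i < #|V|) (enum_val i == w)%:R * x (enum_val i) = x w.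
    rewrite (reindex (@enum_rank V)); last exact/onW_bij/enum_rank_bij.
    rewrite (bigD1 w)//= enum_rankK eqxx mul1r big1 ?addr0// => z /negPf zw.
    by rewrite enum_rankK zw mul0r.
  rewrite /edge_drop mxE -(pick u) -(pick v) -sumrB; apply: eq_bigr => i _.
  by rewrite !mxE AE mulrBl.
rewrite eE; split=> [/subr0_eq xuv a b|xe].
  by rewrite !inE => /orP[]/eqP-> /orP[]/eqP->.
by apply/eqP; rewrite subr_eq0; apply/eqP/xe; rewrite !inE eqxx ?orbT.
Qed.

Variables I P : {set V}.
Variable L : {set edge E}.

Let Hd d := Hp A I P L (diag_of_tuple d).

Lemma identity_rows_mulE (T : finType) (S : {set T}) m (B : 'M[R]_(#|T|, m)) :
  identity_rows R S *m B = rowsub (fun k : 'I_#|S| => enum_rank (enum_val k)) B.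
Proof. by rewrite /identity_rows -rowsubE. Qed.

(** The value at node [i] of the weighted Laplacian of [x]. *)
Definition balance d (x : V -> R) i : R :=
  \sum_(e : edge E)
    A (enum_rank i) (enum_rank e) * tnth d (enum_rank e) * edge_drop x e.

Definition in_kernel d (x : V -> R) : Prop :=
  [/\ forall p, p \in P -> x p = 0,
      forall e, e \in L -> tnth d (enum_rank e) * edge_drop x e = 0
    & forall i, i \in I -> balance d x i = 0].

Lemma diag_mulE d m (B : 'M[R]_(m, #|{: edge E}|)) i k :
  (B *m diag_of_tuple d) i k = B i k * tnth d k.
Proof. by rewrite /diag_of_tuple mul_mx_diag !mxE. Qed.

Lemma balanceE d x i :
  (A *m diag_of_tuple d *m (A^T *m potential_col x)) (enum_rank i) 0 =
  balance d x i.
Proof.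
rewrite mxE (reindex (@enum_rank (edge E))); last exact/onW_bij/enum_rank_bij.
by apply: eq_bigr => e _; rewrite diag_mulE.
Qed.

Lemma Hp_kernelP d (x : V -> R) :
  Hd d *m potential_col x = 0 <-> in_kernel d x.
Proof.
rewrite /Hd /Hp !mul_col_mx -!mulmxA !identity_rows_mulE.
set BI := rowsub _ _; set BL := rowsub _ _; set BP := rowsub _ _.
have BIE k : BI k 0 = balance d x (enum_val k).
  by rewrite mxE mulmxA balanceE.
have BLE k :
    BL k 0 = tnth d (enum_rank (enum_val k)) * edge_drop x (enum_val k).
  by rewrite mxE /diag_of_tuple mul_diag_mx mxE [X in X * _]mxE.
have BPE k : BP k 0 = x (enum_val k) by rewrite !mxE enum_rankK.
split=> [/eqP|[xP xL xI]].
  rewrite !col_mx_eq0 => /and3P[/eqP BI0 /eqP BL0 /eqP BP0]; split.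
  - by move=> p pP; rewrite -(enum_rankK_in pP pP) -BPE BP0 mxE.
  - by move=> e eL; rewrite -(enum_rankK_in eL eL) -BLE BL0 mxE.
  - by move=> i iI; rewrite -(enum_rankK_in iI iI) -BIE BI0 mxE.
suff [-> -> ->] : [/\ BI = 0, BL = 0 & BP = 0] by rewrite !col_mx0.
split; apply/matrixP => k j; rewrite ord1.
- by rewrite BIE mxE; apply/xI/enum_valP.
- by rewrite BLE mxE; apply/xL/enum_valP.
- by rewrite BPE mxE; apply/xP/enum_valP.
Qed.

Lemma Hp_row_fullP d :
  row_full (Hd d) <-> forall x, in_kernel d x -> forall v, x v = 0.
Proof.
rewrite row_full_kerP; split=> [ker0 x /Hp_kernelP/ker0 x0 v|ker0 y].
  by move/matrixP: x0 => /(_ (enum_rank v) 0); rewrite !mxE enum_rankK.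
pose x v := y (enum_rank v) 0.
have -> : y = potential_col x.
  by apply/colP => i; rewrite mxE /x enum_valK.
by move=> /Hp_kernelP/ker0 x0; apply/colP => i; rewrite !mxE x0.
Qed.

Lemma polyfun_Hp i j : polyfun (fun d => Hd d i j).
Proof.
pose n := #|{: edge E}|.
have pfD m (B : 'M[R]_(m, n)) k l :
    polyfun (fun d => (B *m diag_of_tuple d *m A^T) k l).
  rewrite (_ : (fun=> _) = fun d => \sum_e B k e * tnth d e * A^T e l).
    apply: polyfun_sum => e; apply: polyfunM; last exact: polyfun_cst.
    by apply: polyfunM; [exact: polyfun_cst|exact: polyfun_coord].
  by apply/funext => d; rewrite mxE; apply: eq_bigr => e _; rewrite diag_mulE.
rewrite /Hd /Hp; case: (split_ordP i) => [k ->|{}i ->].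
  rewrite (_ : (fun=> _) = fun d =>
    (identity_rows R I *m A *m diag_of_tuple d *m A^T) k j); first exact: pfD.
  by apply/funext => d; rewrite col_mxEu.
case: (split_ordP i) => [k ->|{}k ->].
  rewrite (_ : (fun=> _) = fun d =>
    (identity_rows R L *m diag_of_tuple d *m A^T) k j); first exact: pfD.
  by apply/funext => d; rewrite col_mxEd col_mxEu.
rewrite (_ : (fun=> _) = fun=> identity_rows R P k j); first exact: polyfun_cst.
by apply/funext => d; rewrite !col_mxEd.
Qed.

(** The determinant of a square submatrix that is invertible at [d0] is a
polynomial in the weights, nonzero at [d0]. *)
Lemma ae_row_full d0 : row_full (Hd d0) ->
  {ae lebesgue_tuple #|{: edge E}|,
    forall d : #|{: edge E}|.-tuple (measurableTypeR R), \rank (Hd d) = #|V|}.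
Proof.
move=> full0; pose s := fullrankfun full0.
have pdet : polyfun (fun d => \det (rowsub s (Hd d))).
  apply: polyfun_det => i j.
  rewrite (_ : (fun=> _) = fun d => Hd d (s i) j); first exact: polyfun_Hp.
  by apply/funext => d; rewrite mxE.
have det0 : \det (rowsub s (Hd d0)) != 0.
  by rewrite -unitfE -unitmxE; exact: fullrowsub_unit.
apply: filterS (ae_polyfun_neq0 pdet det0) => d.
rewrite -unitfE -unitmxE => unitd; apply/eqP; rewrite eqn_leq rank_leq_col /=.
by rewrite -{1}(mxrank_unit unitd) mxrankS// rowsub_sub.
Qed.

End WeightedSystem.

(** * Assigning an incident edge to each injection node *)

Section Assignments.
Variables (R : realType) (V : finType) (E : {set {set V}}).
Hypothesis simpleE : simple_graph E.
Variable A : 'M[R]_(#|V|, #|{: edge E}|).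
Hypothesis incA : is_incidence_matrix A.
Variables I P : {set V}.
Variable L : {set edge E}.
Local Notation J := {i : V | i \in I}.

(** For a node outside [P] without edges, the indicator of the node would be a
kernel vector. *)
Lemma incident_edge d :
  (forall i, i \in I -> i \in P -> exists2 e, e \in E & i \in e) ->
  row_full (Hp A I P L (diag_of_tuple d)) ->
  forall i, i \in I -> exists e : edge E, i \in val e.
Proof.
move=> noniso /Hp_row_fullP ker0 i iI.
have [iP|iP] := boolP (i \in P).
  by have [e eE ie] := noniso i iI iP; exists (Sub e eE).
apply: contrapT => noe; pose x v : R := (v == i)%:R.
have drop0 e : edge_drop A x e = 0.
  apply/(edge_drop_eq0P incA) => u v ue ve; rewrite /x.
  have neq w : w \in val e -> (w == i) = false.
    by move=> we; apply: contra_notF noe => /eqP <-; exists e.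
  by rewrite !neq.
have /eqP : x i = 0.
  apply: ker0; split=> [p pP|e _|k _]; last 2 first.
  - by rewrite drop0 mulr0.
  - by apply: big1 => e _; rewrite drop0 mulr0.
  by rewrite /x (_ : (p == i) = false)//; apply: contraNF iP => /eqP <-.
by rewrite /x eqxx oner_eq0.
Qed.

(** The row of a node of [I] is a combination of the rows of its edges, so the
exchange lemma applies with [U] spanned by the rows of [P] and [L]. *)
Lemma row_full_assignment d :
  (forall i, i \in I -> exists e : edge E, i \in val e) ->
  row_full (Hp A I P L (diag_of_tuple d)) ->
  exists g : J -> edge E, (forall i, val i \in val (g i)) /\
    determines R (L :|: [set g i | i : J])%SET P.
Proof.
move=> inc full.
pose D : 'M[R]_ _ := diag_of_tuple d.
pose X (e : edge E) := row (enum_rank e) A^T.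
pose w (j : J) := row (enum_rank (val j)) (A *m D *m A^T).
pose U := (<<identity_rows R P>> + \sum_(e in L) <<X e>>)%MS.
have [|||g [gi gfull]] :=
    @row_full_choice _ _ J (edge E) (fun j e => val j \in val e) X w U.
- by move=> j; exact/inc/valP.
- move=> j; rewrite /w row_mul mulmx_sum_row; apply: summx_sub => k _.
  have [->|] := eqVneq ((row (enum_rank (val j)) (A *m D)) 0 k) 0.
    by rewrite scale0r sub0mx.
  rewrite mxE diag_mulE mulf_eq0 negb_or -(enum_valK k) => /andP[+ _].
  rewrite (incidence_neq0 incA) => je; apply: scalemx_sub.
  by apply: (sumsmx_sup (enum_val k)) => //; rewrite genmxE.
- rewrite -!sub1mx in full *; apply: submx_trans full _.
  rewrite /Hp !col_mx_sub -!mulmxA !identity_rows_mulE.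
  apply/and3P; split.
  + apply/row_subP => k; apply: submx_trans (addsmxSr _ _).
    apply: (sumsmx_sup (Sub (enum_val k) (enum_valP k))) => //.
    by rewrite genmxE /w SubK row_rowsub mulmxA.
  + apply/row_subP => k; apply: submx_trans (addsmxSl _ _).
    apply: submx_trans (addsmxSr _ _).
    apply: (sumsmx_sup (enum_val k)); first exact: enum_valP.
    rewrite genmxE row_rowsub row_mul row_diag_mx -scalemxAl -rowE.
    exact: scalemx_sub.
  + apply: submx_trans (addsmxSl _ _).
    by rewrite -(genmxE (identity_rows R P)) addsmxSl.
exists g; split=> // x xP xK v.
have XE e : flat x (val e) -> X e *m potential_col x = 0.
  move=> /(edge_drop_eq0P incA) xe; apply/matrixP => a b.
  by rewrite !ord1 -row_mul mxE [RHS]mxE; exact: xe.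
have : potential_col x = 0.
  move/row_full_kerP: gfull; apply; apply/sub_kermxP.
  rewrite !addsmx_sub genmxE -andbA; apply/and3P; split.
  - apply/sub_kermxP; rewrite identity_rows_mulE; apply/matrixP => k l.
    by rewrite !mxE enum_rankK xP// enum_valP.
  - apply/sumsmx_subP => e eL; rewrite genmxE; apply/sub_kermxP/XE/xK.
    by rewrite inE eL.
  - apply/sumsmx_subP => j _; rewrite genmxE; apply/sub_kermxP/XE/xK.
    by rewrite inE imset_f ?orbT.
by move=> /matrixP/(_ (enum_rank v) 0); rewrite !mxE enum_rankK.
Qed.

Lemma flat_pair (x : V -> R) (u v : V) : flat x [set u; v]%SET <-> x u = x v.
Proof.
split=> [|xuv a b]; first by apply; rewrite !inE eqxx ?orbT.
by rewrite !inE => /orP[]/eqP-> /orP[]/eqP->.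
Qed.

(** Iterates on a finite set repeat by the pigeonhole principle; the cycle of
least period returns to [c] only at its end. *)
Lemma iter_first_return (T : finType) (W : {set T}) (f : T -> T) (j0 : T) :
  (forall j, j \in W -> f j \in W) -> j0 \in W ->
  exists2 c, c \in W & exists m, [/\ iter m.+1 f c = c &
    forall k, (k < m)%N -> iter k.+1 f c != c].
Proof.
move=> fW j0W.
have iterW k j : j \in W -> iter k f j \in W by elim: k => //= k IH /IH/fW.
have [a [b [ab fab]]] : exists a b, (a < b)%N /\ iter a f j0 = iter b f j0.
  pose F (k : 'I_#|T|.+1) := iter k f j0.
  have /injectivePn[a [b ab Fab]] : ~~ injectiveb F.
    by apply/negP => /injectiveP/leq_card; rewrite card_ord ltnn.
  have [ltab|ltba|/val_inj/eqP] := ltngtP a b; last by rewrite (negPf ab).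
    by exists a, b.
  by exists b, a.
exists (iter a f j0); first exact: iterW.
set c := iter a f j0.
have ex : exists m, iter m.+1 f c == c.
  exists (b - a).-1; rewrite prednK ?subn_gt0//.
  by rewrite /c -iterD subnK -?fab// ltnW.
exists (ex_minn ex); case: ex_minnP => m /eqP cm mmin; split=> // k km.
by apply: contraL km => /mmin; rewrite -leqNgt.
Qed.

(** By induction on the size of [S], with weight 1 on the edges of [L] and on
[g j] for [j] in [S], and weight 0 elsewhere.  Let [h j] be the other end of
[g j], let [x] be a nonzero kernel vector and [W] the set of those [j] in [S]
along whose edge [g j] the potential drops.  The balance equation at [j] in [W]
must contain a second edge with a nonzero drop, and this can only be [g i] with
[i] in [W] and [h i = j].  Going backwards in this way yields a cycle through
some [c].  A potential constant on all edges of the cycle but [g c] is constant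
on [g c] as well, so [c] can be removed from [S]. *)
Lemma assignment_row_full (g : J -> edge E) : (forall i, val i \in val (g i)) ->
  forall S : {set J}, determines R (L :|: [set g i | i in S])%SET P ->
  exists d, row_full (Hp A I P L (diag_of_tuple d)).
Proof.
move=> gi.
have /fin_all_exists[h hE] (j : J) : exists v, v != val j /\
    val (g j) = [set val j; v]%SET.
  have [v vg vj] : exists2 v, v \in val (g j) & v != val j.
    have := simpleE (valP (g j)); rewrite (cardsD1 (val j)) gi add1n => -[].
    move=> /eqP/cards1P[v vE]; have := set11 v.
    by rewrite -vE !inE => /andP[vj vg]; exists v.
  by exists v; split=> //; apply: other_end => //; rewrite eq_sym.
move=> S; have [n] := ubnP #|S|; elim: n S => // n IH S Sn det.
pose K := (L :|: [set g i | i in S])%SET.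
pose d := [tuple (enum_val k \in K)%:R : R | k < #|{: edge E}|].
have dE e : tnth d (enum_rank e) = (e \in K)%:R.
  by rewrite tnth_mktuple enum_rankK.
have [ker0|/existsNP[x /not_implyP[[xP xL xI] /existsNP[v xv]]]] :=
    pselect (forall x, in_kernel A I P L d x -> forall v, x v = 0).
  by exists d; apply/Hp_row_fullP.
have dropL e : e \in L -> edge_drop A x e = 0.
  by move=> eL; have := xL e eL; rewrite dE inE eL mul1r.
pose W := [set j in S | x (val j) != x (h j)].
have drop_g j : j \in S -> j \notin W -> edge_drop A x (g j) = 0.
  move=> jS; rewrite inE jS negbK => /eqP xj; apply/(edge_drop_eq0P incA).
  by rewrite (hE j).2; apply/flat_pair.
(* If [W] were empty, [x] would be constant on every edge of [K]. *)
have [j0 j0W] : exists j0, j0 \in W.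
  apply: contrapT => W0; apply: xv; apply: det => // e.
  rewrite inE => /orP[eL|/imsetP[j jS ->]]; apply/(edge_drop_eq0P incA).
    exact: dropL.
  by apply: drop_g => //; apply/negP => jW; apply: W0; exists j.
have prec j : exists i, j \in W -> i \in W /\ h i = val j.
  apply: contrapT => noi.
  have jW : j \in W by apply: contrapT => jW; apply: noi; exists j.
  have := jW; rewrite inE => /andP[jS /eqP]; apply.
  suff /(edge_drop_eq0P incA) : edge_drop A x (g j) = 0.
    by rewrite (hE j).2 => /flat_pair.
  have := xI _ (valP j); rewrite /balance (bigD1 (g j))//= big1 ?addr0.
    have gK : g j \in K by rewrite inE imset_f ?orbT.
    have /negPf A0 : A (enum_rank (val j)) (enum_rank (g j)) != 0.
      by rewrite (incidence_neq0 incA).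
    by rewrite dE gK mulr1 => /eqP; rewrite mulf_eq0 A0 => /eqP.
  move=> e ej; have [->|] := eqVneq (A (enum_rank (val j)) (enum_rank e)) 0.
    by rewrite !mul0r.
  rewrite (incidence_neq0 incA) dE => je.
  have [|eK] := boolP (e \in K); last by rewrite mulr0 mul0r.
  rewrite inE => /orP[eL|/imsetP[i iS eE]]; first by rewrite dropL// mulr0.
  rewrite eE drop_g ?mulr0//; apply/negP => iW; apply: noi; exists i => _.
  split=> //; move: je; rewrite eE (hE i).2 !inE.
  move=> /orP[/eqP/val_inj ji|/eqP//].
  by rewrite eE ji eqxx in ej.
have [f fP] := fin_all_exists prec.
have [c cW [m [cm mmin]]] := iter_first_return (fun j jW => (fP j jW).1) j0W.
have iterW k : iter k f c \in W by elim: k => //= k /fP[].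
have cS : c \in S by move: cW; rewrite inE => /andP[].
apply: (IH (S :\ c)%SET) => [|y yP yK].
  by move: Sn; rewrite (cardsD1 c) cS.
have yg j : j \in S -> j != c -> y (val j) = y (h j).
  move=> jS jc; apply/flat_pair; rewrite -(hE j).2; apply: yK.
  by rewrite inE imset_f ?orbT// !inE jc.
(* Along the cycle from [c] backwards; all steps avoid the edge [g c]. *)
have yc k : (k <= m)%N -> y (val (iter k f c)) = y (val c).
  elim: k => // k IHk km; rewrite -(IHk (ltnW km)) yg.
  - by rewrite (fP _ (iterW k)).2.
  - by have := iterW k.+1; rewrite inE => /andP[].
  - exact: mmin.
apply: det => // e; rewrite inE => /orP[eL|/imsetP[j jS ->]].
  by apply: yK; rewrite inE eL.
rewrite (hE j).2; apply/flat_pair; have [->|/yg->//] := eqVneq j c.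
by rewrite -{2}cm iterS (fP _ (iterW m)).2 yc.
Qed.

End Assignments.

Theorem mainTheorem1 (R : realType) (V : finType) (E : {set {set V}})
  (simpleE : simple_graph E)
  (A : 'M[R]_(#|V|, #|{: edge E}|)) (incA : is_incidence_matrix A)
  (I P : {set V}) (L : {set edge E})
  (* without this hypothesis the claim fails: V = I = P = {v}, E empty *)
  (noniso : forall i, i \in I -> i \in P -> exists2 e, e \in E & i \in e) :
  {ae lebesgue_tuple #|{: edge E}|,
    forall d : #|{: edge E}|.-tuple (measurableTypeR R),
      \rank (Hp A I P L (diag_of_tuple d)) = #|V|}
  <->
  exists g : {i : V | i \in I} -> edge E,
    (forall i, val i \in val (g i)) /\
    connected_graph (augmented_edges L P g).
Proof.
split=> [aefull|[g [gi conn]]].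
  have nontrivial := ae_properfilter_algebraOfSetsType (lebesgue_tuple_gt0 _).
  have [d /eqP full] := @filter_ex _ _ (nontrivial _ _) _ aefull.
  have inc := incident_edge incA noniso full.
  have [g [gi det]] := row_full_assignment incA inc full.
  exists g; split=> //; rewrite augmented_edgesE.
  exact/(connected_groundedP R simpleE).
rewrite augmented_edgesE in conn.
have /(connected_groundedP R simpleE) det := conn.
have gT : ([set g i | i in [set: {i : V | i \in I}]] =
           [set g i | i : {i : V | i \in I}])%SET.
  apply/finset.setP => e.
  by apply/imsetP/imsetP => -[i _ ->]; exists i; rewrite ?inE.
rewrite -gT in det.
have [d full] := assignment_row_full simpleE incA gi det.
exact: ae_row_full full.
Qed.
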